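(* Let $\bar{x}\in\Omega$ be a feasible solution of (CTP), and suppose that (H1) and (H2) are satisfied at $\bar{x}$. Then: (a) Assume that AKKT-regularity is satisfied at $\bar{x}$. If $\bar{x}$ is a pw-AKKT solution of (CTP), then $\bar{x}$ is a KKT solution of (CTP). (b) If for every function $\phi:\mathbb{R}^n\times[0,T]\to\mathbb{R}$ satisfying (H1) at $\bar{x}$ the following implication holds for the problem (CTP) with objective integrand $\phi$ (and the same constraint functions $h,g$): ''$\bar{x}$ is a pw-AKKT solution $\Rightarrow$ $\bar{x}$ is a KKT solution'', then AKKT-regularity is satisfied at $\bar{x}$.
   Context: Problem. Let $T>0$, and let $\phi:\mathbb{R}^n\times[0,T]\to\mathbb{R}$, $h=(h_1,\dots,h_p):\mathbb{R}^n\times[0,T]\to\mathbb{R}^p$, $g=(g_1,\dots,g_m):\mathbb{R}^n\times[0,T]\to\mathbb{R}^m$ be given; $I=\{1,\dots,p\}$, $J=\{1,\dots,m\}$. Problem (CTP): minimize $P(x)=\int_0^T\phi(x(t),t)\,dt$ over $x\in L^\infty([0,T];\mathbb{R}^n)$ subject to $h(x(t),t)=0$ and $g(x(t),t)\le 0$ for a.e. $t\in[0,T]$ (vector inequalities are componentwise, integrals are Lebesgue integrals). The feasible set is $\Omega=\{x\in L^\infty([0,T];\mathbb{R}^n): h(x(t),t)=0,\ g(x(t),t)\le 0 \text{ for a.e. } t\in[0,T]\}$ (it does not depend on $\phi$). For a given $\bar{x}\in\Omega$ and $r>0$, $B_r(t)=\{x\in\mathbb{R}^n:\|x-\bar{x}(t)\|<r\}$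 and $\bar{B}_r(t)=\{x\in\mathbb{R}^n:\|x-\bar{x}(t)\|\le r\}$, for a.e. $t$. Assumptions. (H1) and (H2) are satisfied at $\bar{x}\in\Omega$ if there is $r>0$ (fixed from now on, the same $r$ being used in all the definitions below) such that: (H1) $\phi(\cdot,t)$ is continuously differentiable for a.e. $t\in[0,T]$; $\phi(x,\cdot)$ is Lebesgue measurable for each $x$; $|\phi(\bar{x}(\cdot),\cdot)|$ is integrable on $[0,T]$; there are integrable functions $c_\phi,\hat{c}_\phi$ on $[0,T]$ with $|\phi(x,t)-\phi(y,t)|\le c_\phi(t)\|x-y\|$ for all $x,y\in\bar{B}_r(t)$ and $\|\nabla_x\phi(x,t)\|\le\hat{c}_\phi(t)$ for all $x\in\bar{B}_r(t)$, for a.e. $t\in[0,T]$. (H2) $(h,g)(\cdot,t)$ is continuously differentiable for a.e. $t\in[0,T]$; $(h,g)(x,\cdot)$ is Lebesgue measurable for each $x$; $\|(h,g)(\bar{x}(\cdot),\cdot)\|$ is integrable on $[0,T]$; there are integrable functions $c_{h,g},\hat{c}_{h,g}$ on $[0,T]$ with $\|(h,g)(x,t)-(h,g)(y,t)\|\le c_{h,g}(t)\|x-y\|$ for all $x,y\in\bar{B}_r(t)$ and $\|\nabla_x(h,g)(x,t)\|\le\hat{c}_{h,g}(t)$ for all $x\in\bar{B}_r(t)$, for a.e. $t\in[0,T]$. Lagrangian. $L(x,u,v,t)=\phi(x,t)+\sum_{i=1}^p u_ih_i(x,t)+\sum_{j=1}^m v_jg_j(x,t)$. Put $g_j^-(x,t)=\max\{-g_j(x,t),0\}$.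 KKT solution. $\bar{x}\in\Omega$ is a KKT solution of (CTP) if there exist $u\in L^\infty([0,T];\mathbb{R}^p)$ and $v\in L^\infty([0,T];\mathbb{R}^m)$ such that for a.e. $t\in[0,T]$: $\nabla_xL(\bar{x}(t),u(t),v(t),t)=0$, and $v_j(t)g_j(\bar{x}(t),t)=0$, $v_j(t)\ge 0$ for all $j\in J$. pw-AKKT solution. A sequence $\{(x^k,u^k,v^k)\}\subset L^\infty([0,T];\mathbb{R}^n\times\mathbb{R}^p\times\mathbb{R}^m)$ is an AKKT sequence for (CTP) at $\bar{x}$ if $\int_0^T\nabla_xL(x^k(t),u^k(t),v^k(t),t)\cdot\gamma(t)\,dt\to0$ for all $\gamma\in L^\infty([0,T];\mathbb{R}^n)$ (equivalently, $\nabla_xL(x^k(\cdot),u^k(\cdot),v^k(\cdot),\cdot)\rightharpoonup0$ weakly in $L^1([0,T];\mathbb{R}^n)$), and for all $j\in J$ and a.e. $t\in[0,T]$: $v_j^k(t)g_j^-(x^k(t),t)\to0$ and $v_j^k(t)\ge0$. $\bar{x}\in\Omega$ is a pw-AKKT solution for (CTP) if there is an AKKT sequence $\{(x^k,u^k,v^k)\}$ for (CTP) at $\bar{x}$ such that $x^k(t)\to\bar{x}(t)$ for a.e. $t\in[0,T]$ and $x^k(t)\in B_r(t)$ for a.e. $t\in[0,T]$ and all $k\in\mathbb{N}$. AKKT-regularity. Let $E=\{x\in L^\infty([0,T];\mathbb{R}^n): x(t)\in B_r(t)\text{ a.e. }t\in[0,T]\}$, $F=\{\theta\in L^1([0,T];\mathbb{R}^m):\theta(t)\ge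 0\text{ a.e. }t\in[0,T]\}$. For $(x,\theta)\in E\times F$, $\mathcal{M}(x,\theta)$ is the set of all $\psi\in L^1([0,T];\mathbb{R}^n)$ for which there is $(u,v)\in L^\infty([0,T];\mathbb{R}^p\times\mathbb{R}^m)$ such that, for a.e. $t\in[0,T]$, $\psi(t)=\sum_{i=1}^p u_i(t)\nabla_xh_i(x(t),t)+\sum_{j=1}^m v_j(t)\nabla_xg_j(x(t),t)$, $v_j(t)g_j^-(x(t),t)=\theta_j(t)$ and $v_j(t)\ge0$ for all $j\in J$. The weak outer limit $\mathrm{w}\text{-}\limsup_{(x,\theta)\to(\bar{x},0)}\mathcal{M}(x,\theta)$ is the set of all $\psi\in L^1([0,T];\mathbb{R}^n)$ for which there exist $\{(x^k,\theta^k)\}\subset E\times F$ with $(x^k(t),\theta^k(t))\to(\bar{x}(t),0)$ for a.e. $t\in[0,T]$ and $\psi^k\in\mathcal{M}(x^k,\theta^k)$ for all $k\in\mathbb{N}$ with $\psi^k\rightharpoonup\psi$ weakly in $L^1([0,T];\mathbb{R}^n)$. AKKT-regularity is satisfied at $\bar{x}$ if $\mathrm{w}\text{-}\limsup_{(x,\theta)\to(\bar{x},0)}\mathcal{M}(x,\theta)\subset\mathcal{M}(\bar{x},0)$. *)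

(* Defs.v *)
From HB Require Import structures.
From mathcomp Require Import all_boot all_order all_algebra.
From mathcomp Require Import all_classical all_reals all_analysis.

Set Implicit Arguments.
Unset Strict Implicit.
Unset Printing Implicit Defensive.

Import Order.TTheory GRing.Theory Num.Theory.
Import numFieldNormedType.Exports.

Local Open Scope classical_set_scope.
Local Open Scope ring_scope.

(* The real line with the sigma-algebra of Lebesgue-measurable sets
   ([completed_caratheodory_measurable] identifies it with the completion of
   the Borel sets); [measurableTypeR R] only has the Borel sets. *)
Definition lebesgueType (R : realType) : measurableType _ :=
  caratheodory_type ((@wlength R idfun)^*)%mu.

Definition leb (R : realType) : {measure set (lebesgueType R) -> \bar R} :=
  @completed_lebesgue_measure R.

Section EuclideanSpace.
Context {R : realType}.

Definition dotv {n : nat} (x y : 'rV[R]_n) : R := \sum_(i < n) x 0 i * y 0 i.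

(* Euclidean norm of a row vector, Frobenius norm of a matrix.  The library
   norm [`|A|] on matrices is the sup norm; it induces the same topology. *)
Definition enorm {a b : nat} (A : 'M[R]_(a, b)) : R :=
  Num.sqrt (\sum_(i < a) \sum_(j < b) A i j ^+ 2).

Definition gradient {n : nat} (f : 'rV[R]_n -> R) (x : 'rV[R]_n) : 'rV[R]_n :=
  \row_(i < n) 'D_(delta_mx 0 i) f x.

Definition C1 {n : nat} (f : 'rV[R]_n -> R) : Prop :=
  (forall x, differentiable f x) /\ continuous (gradient f).

(* With row vectors [jacobian f x] is the transpose of the usual Jacobian;
   its Frobenius norm is the same. *)
Definition C1_vec {n q : nat} (f : 'rV[R]_n -> 'rV[R]_q) : Prop :=
  (forall x, differentiable f x) /\ continuous (jacobian f).

End EuclideanSpace.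

(* A function on [0, T] is represented by a total function on R, of which only
   the restriction to [0, T] (up to null sets) is ever constrained. *)
Section FunctionSpaces.
Context {R : realType}.
Variable T : R.

Definition horizon : set (lebesgueType R) := `[0, T]%classic.

Definition ae_on (P : R -> Prop) : Prop :=
  \forall t \ae leb R, horizon t -> P t.

Definition meas (f : R -> R) : Prop :=
  @measurable_fun _ _ (lebesgueType R) R horizon f.

Definition integ (f : R -> R) : Prop :=
  (leb R).-integrable horizon (EFin \o f).

Definition measv {n : nat} (f : R -> 'rV[R]_n) : Prop :=
  forall i, meas (fun t => f t 0 i).

Definition L1 {n : nat} (f : R -> 'rV[R]_n) : Prop :=
  forall i, integ (fun t => f t 0 i).

Definition Linf {n : nat} (f : R -> 'rV[R]_n) : Prop :=
  measv f /\ exists M : R, ae_on (fun t => enorm (f t) <= M).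

(* Weak convergence in L^1; the membership of the terms and of the limit in
   L^1 is required where this is used. *)
Definition weak_cvg_L1 {n : nat} (f : nat -> R -> 'rV[R]_n)
    (l : R -> 'rV[R]_n) : Prop :=
  forall gamma : R -> 'rV[R]_n, Linf gamma ->
    \int[leb R]_(t in horizon) dotv (f k t) (gamma t) @[k --> \oo] -->
    \int[leb R]_(t in horizon) dotv (l t) (gamma t).

End FunctionSpaces.

Section CTP.
Context {R : realType} {n p m : nat}.
Variable T : R.
Variables (h : 'rV[R]_n -> R -> 'rV[R]_p) (g : 'rV[R]_n -> R -> 'rV[R]_m).

Definition feasible (x : R -> 'rV[R]_n) : Prop :=
  Linf T x /\
  ae_on T (fun t => h (x t) t = 0 /\ forall j, g (x t) t 0 j <= 0).

Definition hg (x : 'rV[R]_n) (t : R) : 'rV[R]_(p + m) :=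
  row_mx (h x t) (g x t).

Definition gneg (j : 'I_m) (x : 'rV[R]_n) (t : R) : R :=
  Num.max (- g x t 0 j) 0.

Definition grad_h (i : 'I_p) (x : 'rV[R]_n) (t : R) : 'rV[R]_n :=
  gradient (fun y => h y t 0 i) x.

Definition grad_g (j : 'I_m) (x : 'rV[R]_n) (t : R) : 'rV[R]_n :=
  gradient (fun y => g y t 0 j) x.

Definition lagrangian (phi : 'rV[R]_n -> R -> R)
    (x : 'rV[R]_n) (u : 'rV[R]_p) (v : 'rV[R]_m) (t : R) : R :=
  phi x t + \sum_(i < p) u 0 i * h x t 0 i + \sum_(j < m) v 0 j * g x t 0 j.

Definition grad_lagrangian (phi : 'rV[R]_n -> R -> R)
    (x : 'rV[R]_n) (u : 'rV[R]_p) (v : 'rV[R]_m) (t : R) : 'rV[R]_n :=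
  gradient (fun y => lagrangian phi y u v t) x.

Definition KKT (phi : 'rV[R]_n -> R -> R) (xbar : R -> 'rV[R]_n) : Prop :=
  feasible xbar /\
  exists (u : R -> 'rV[R]_p) (v : R -> 'rV[R]_m),
    [/\ Linf T u, Linf T v &
        ae_on T (fun t =>
          grad_lagrangian phi (xbar t) (u t) (v t) t = 0 /\
          forall j, v t 0 j * g (xbar t) t 0 j = 0 /\ 0 <= v t 0 j)].

(* The integrals in the first limit are required to exist for every test
   function, i.e. the gradients of the Lagrangian belong to L^1. *)
Definition AKKT_sequence (phi : 'rV[R]_n -> R -> R)
    (x : nat -> R -> 'rV[R]_n) (u : nat -> R -> 'rV[R]_p)
    (v : nat -> R -> 'rV[R]_m) : Prop :=
  [/\ forall k, [/\ Linf T (x k), Linf T (u k) & Linf T (v k)],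
      forall k, L1 T (fun t => grad_lagrangian phi (x k t) (u k t) (v k t) t),
      forall gamma : R -> 'rV[R]_n, Linf T gamma ->
        \int[leb R]_(t in horizon T)
          dotv (grad_lagrangian phi (x k t) (u k t) (v k t) t) (gamma t)
          @[k --> \oo] --> (0 : R) &
      forall j, ae_on T (fun t =>
        (v k t 0 j * gneg j (x k t) t @[k --> \oo] --> (0 : R)) /\
        forall k, 0 <= v k t 0 j)].

Section AtReferencePoint.
Variables (xbar : R -> 'rV[R]_n) (r : R).

Definition oball (t : R) : set 'rV[R]_n := [set x | enorm (x - xbar t) < r].
Definition cball (t : R) : set 'rV[R]_n := [set x | enorm (x - xbar t) <= r].

Definition H1 (phi : 'rV[R]_n -> R -> R) : Prop :=
  [/\ ae_on T (fun t => C1 (phi ^~ t)),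
      forall x, meas T (phi x),
      integ T (fun t => `|phi (xbar t) t|) &
      exists c chat : R -> R, [/\ integ T c, integ T chat &
        ae_on T (fun t =>
          (forall x y, cball t x -> cball t y ->
             `|phi x t - phi y t| <= c t * enorm (x - y)) /\
          (forall x, cball t x -> enorm (gradient (phi ^~ t) x) <= chat t))]].

Definition H2 : Prop :=
  [/\ ae_on T (fun t => C1_vec (hg ^~ t)),
      forall x, measv T (hg x),
      integ T (fun t => enorm (hg (xbar t) t)) &
      exists c chat : R -> R, [/\ integ T c, integ T chat &
        ae_on T (fun t =>
          (forall x y, cball t x -> cball t y ->
             enorm (hg x t - hg y t) <= c t * enorm (x - y)) /\
          (forall x, cball t x -> enorm (jacobian (hg ^~ t) x) <= chat t))]].

Definition pw_AKKT (phi : 'rV[R]_n -> R -> R) : Prop :=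
  feasible xbar /\
  exists (x : nat -> R -> 'rV[R]_n) (u : nat -> R -> 'rV[R]_p)
         (v : nat -> R -> 'rV[R]_m),
    [/\ AKKT_sequence phi x u v,
        ae_on T (fun t => x k t @[k --> \oo] --> xbar t) &
        forall k, ae_on T (fun t => oball t (x k t))].

Definition setE : set (R -> 'rV[R]_n) :=
  [set x | Linf T x /\ ae_on T (fun t => oball t (x t))].

Definition setF : set (R -> 'rV[R]_m) :=
  [set theta | L1 T theta /\ ae_on T (fun t => forall j, 0 <= theta t 0 j)].

Definition setM (x : R -> 'rV[R]_n) (theta : R -> 'rV[R]_m) :
    set (R -> 'rV[R]_n) :=
  [set psi | L1 T psi /\
    exists (u : R -> 'rV[R]_p) (v : R -> 'rV[R]_m),
      [/\ Linf T u, Linf T v &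
          ae_on T (fun t =>
            psi t = \sum_(i < p) u t 0 i *: grad_h i (x t) t
                    + \sum_(j < m) v t 0 j *: grad_g j (x t) t /\
            forall j, v t 0 j * gneg j (x t) t = theta t 0 j /\
                      0 <= v t 0 j)]].

Definition wlimsup_M : set (R -> 'rV[R]_n) :=
  [set psi | L1 T psi /\
    exists (x : nat -> R -> 'rV[R]_n) (theta : nat -> R -> 'rV[R]_m)
           (psik : nat -> R -> 'rV[R]_n),
      [/\ forall k, setE (x k) /\ setF (theta k),
          ae_on T (fun t => (x k t @[k --> \oo] --> xbar t) /\
                            (theta k t @[k --> \oo] --> (0 : 'rV[R]_m))),
          forall k, setM (x k) (theta k) (psik k) &
          weak_cvg_L1 T psik psi]].

Definition AKKT_regular : Prop :=
  wlimsup_M `<=` setM xbar (fun=> 0).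

End AtReferencePoint.
End CTP.

(* Main.v *)
Require Import Defs.
From mathcomp Require Import all_boot all_order all_algebra.
From mathcomp Require Import all_classical all_reals all_analysis.
From mathcomp Require Import measurable_realfun.

Set Implicit Arguments.
Unset Strict Implicit.
Unset Printing Implicit Defensive.

Import Order.TTheory GRing.Theory Num.Theory.
Import numFieldNormedType.Exports.

Local Open Scope classical_set_scope.
Local Open Scope ring_scope.

(** Fix the constraints [h], [g] and the reference point [xbar]. The objective
    integrand [phi] enters the optimality conditions only through the function
    [a t := - gradient (phi ^~ t) (xbar t)], and both conditions are
    memberships of [a]:
    - [xbar] is a KKT point iff [a] belongs to [setM xbar 0]
      ([KKT_iff_setM]);
    - [xbar] is a pw-AKKT point iff [a] belongs to the weak outer limit
      [wlimsup_M] ([pw_AKKT_iff_wlimsup_M]).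
    Regularity, which is the inclusion of the second set in the first,
    therefore turns pw-AKKT points into KKT points. For the converse, every
    [psi] of the outer limit arises as such an [a]: the linear integrand
    [phi' y t = - (psi t . y)] satisfies (H1) because [psi] is integrable, and
    its gradient is [- psi t] ([H1_dotv], [gradient_dotv]).

    The first equivalence is the sum rule for the gradient of the Lagrangian,
    together with the fact that complementarity against the negative part
    of [g] is complementarity against [g] itself where [g <= 0]. In the second
    one, along a sequence [x k] converging to [xbar], the elements of
    [setM (x k)] are the gradients of the Lagrangian minus the gradients
    of [phi], and the latter converge weakly in L^1 by dominated
    convergence, (H1) giving the dominating function ([gradient_weak_cvg]).
    Whether the former tend weakly to 0 or the elements of [setM (x k)] tend
    weakly to [a] is thus the same question.

    The analytic difficulty is measurability of the superpositions
    [t |-> phi (x t) t], [t |-> g (x t) t] and of the gradients along [x],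
    since the data are only measurable in [t] for a fixed point and, for
    almost every [t], smooth in the point. This is [measurable_caratheodory]
    and [measurable_gradient]; both use completeness of the Lebesgue measure,
    as the regularity in the point fails on a null set. *)

(** * Rounding vectors to a grid *)

Section Grid.
Context {R : realType}.

Lemma cvg_rV {I : Type} {F : set_system I} {FF : Filter F} {n : nat}
    (f : I -> 'rV[R]_n) (l : 'rV[R]_n) :
  (forall i, f k 0 i @[k --> F] --> l 0 i) -> f k @[k --> F] --> l.
Proof.
move=> fl; apply/cvgrPdist_lt => e e0; near=> k.
rewrite /Num.Def.normr/= mx_normrE; apply: bigmax_lt => //= -[i j] _ /=.
rewrite (ord1 i) !mxE; move: j; near: k; apply: filter_forall => j.
exact: (@cvgrPdist_lt _ _ _ _ FF (fun k => f k 0 j) (l 0 j)).1 (fl j) e e0.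
Unshelve. all: by end_near. Qed.

(** Rounding goes through the integer index of the cell, so that the rounded
    vector is a function of an element of a countable type. *)
Definition grid_point {n : nat} (k : nat) (z : 'rV[int]_n) : 'rV[R]_n :=
  \row_i ((z 0 i)%:~R / k.+1%:R).

Definition grid_index {n : nat} (k : nat) (y : 'rV[R]_n) : 'rV[int]_n :=
  \row_i Num.floor (k.+1%:R * y 0 i).

Lemma grid_cvg {n : nat} (y : 'rV[R]_n) :
  grid_point k (grid_index k y) @[k --> \oo] --> y.
Proof.
apply: cvg_rV => i.
apply: (@squeeze_cvgr _ _ _ _ (fun k => y 0 i - k.+1%:R^-1) (fun=> y 0 i)).
- apply: nearW => k; rewrite !mxE.
  have k0 : (0 : R) < k.+1%:R by [].
  have /andP[lo hi] := floor_itv (k.+1%:R * y 0 i).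
  rewrite ler_pdivlMr// ler_pdivrMr// mulrBl mulVf ?gt_eqF//.
  by rewrite (mulrC (y 0 i)) lo andbT lerBlDr ltW// -intrD1.
- rewrite -[X in _ --> X]subr0; apply: cvgB; first exact: cvg_cst.
  exact: cvg_harmonic.
- exact: cvg_cst.
Qed.

End Grid.

(** * Measurability for a complete measure *)

Section CompleteMeasure.
Context d (T : measurableType d) (R : realType).
Variable mu : {measure set T -> \bar R}.
Hypothesis mu_complete : measure_is_complete mu.
Variable D : set T.
Hypothesis mD : measurable D.

Lemma ae_eq_measurable (f f' : T -> R) :
  (\forall t \ae mu, D t -> f t = f' t) ->
  measurable_fun D f -> measurable_fun D f'.
Proof.
move=> ff' /measurable_EFinP mf; apply/measurable_EFinP.
apply: (ae_measurable_fun mu_complete _ mf).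
by apply: filterS ff' => t ff' Dt /=; rewrite ff'.
Qed.

(** The upper limit of the sequence is measurable, and completeness allows it
    to be replaced by the almost everywhere limit. *)
Lemma ae_cvg_measurable (f_ : nat -> T -> R) (f : T -> R) :
  (forall k, measurable_fun D (f_ k)) ->
  (\forall t \ae mu, D t -> f_ k t @[k --> \oo] --> f t) ->
  measurable_fun D f.
Proof.
move=> mf_ f_f; apply/measurable_EFinP.
apply: (ae_measurable_fun mu_complete
  (f := fun t => limn_esup (fun k => (f_ k t)%:E))).
  apply: filterS f_f => t f_f Dt /=.
  have /cvg_limn_einf_sup[_ //] : (f_ k t)%:E @[k --> \oo] --> (f t)%:E.
  by apply: cvg_EFin; [exact: nearW|exact: f_f].
by apply: measurable_fun_limn_esup => k; apply/measurable_EFinP.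
Qed.

Lemma measurable_grid_index {n : nat} (k : nat) (x : T -> 'rV[R]_n)
    (z : 'rV[int]_n) :
  (forall i, measurable_fun D (fun t => x t 0 i)) ->
  measurable (D `&` [set t | grid_index k (x t) = z]).
Proof.
move=> mx.
rewrite (_ : _ `&` _ = D `&` \bigcap_(i in [set: 'I_n]) (D `&`
    (fun t => k.+1%:R * x t 0 i) @^-1` `[(z 0 i)%:~R, (z 0 i + 1)%:~R[)).
  apply: measurableI => //; apply: fin_bigcap_measurable => // i _.
  exact: measurable_funM.
apply/seteqP; split=> [t [Dt zt]|t [Dt zt]]; split=> //.
  by move=> i _; split=> //=; rewrite in_itv/= -zt mxE; exact: floor_itv.
by apply/rowP => i; rewrite mxE; apply/floor_def; have [] := zt i I.
Qed.

(** Superposition of a Caratheodory function with a measurable one: rounding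
    [x] to a grid leaves countably many values, so the superposition with the
    rounded function is measurable cell by cell; continuity in the first
    variable lets the mesh tend to 0. *)
Theorem measurable_caratheodory {n : nat} (f : 'rV[R]_n -> T -> R)
    (x : T -> 'rV[R]_n) :
  (forall y, measurable_fun D (f y)) ->
  (\forall t \ae mu, D t -> continuous (f ^~ t)) ->
  (forall i, measurable_fun D (fun t => x t 0 i)) ->
  measurable_fun D (fun t => f (x t) t).
Proof.
move=> mf cf mx.
apply: (ae_cvg_measurable
  (f_ := fun k t => f (grid_point k (grid_index k (x t))) t)).
  move=> k _ Y mY.
  rewrite (_ : _ `&` _ = \bigcup_(z in [set: 'rV[int]_n])
      ((D `&` [set t | grid_index k (x t) = z]) `&`
       (D `&` f (grid_point k z) @^-1` Y))).
    apply: countable_bigcupT_measurable => // z.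
    by apply: measurableI; [exact: measurable_grid_index|exact: mf].
  apply/seteqP; split=> [t [Dt Yt]|t [z _ [[Dt zt] [_ Yt]]]].
    by exists (grid_index k (x t)).
  by split=> //; rewrite /preimage/= zt.
apply: filterS cf => t cf Dt.
exact: (cvg_comp _ (f ^~ t) (grid_cvg (y:=x t)) (cf Dt (x t))).
Qed.

(** Each partial derivative is the limit of difference quotients with steps
    [1 / (k + 1)], which are superpositions of Caratheodory type. *)
Lemma measurable_gradient {n : nat} (f : 'rV[R]_n -> T -> R)
    (x : T -> 'rV[R]_n) (i : 'I_n) :
  (forall y, measurable_fun D (f y)) ->
  (\forall t \ae mu, D t -> forall y, differentiable (f ^~ t) y) ->
  (forall i, measurable_fun D (fun t => x t 0 i)) ->
  measurable_fun D (fun t => gradient (f ^~ t) (x t) 0 i).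
Proof.
move=> mf df mx.
have cf : \forall t \ae mu, D t -> continuous (f ^~ t).
  by apply: filterS df => t df Dt z; exact: differentiable_continuous (df Dt z).
have mfx y : measurable_fun D (fun t => f (y + x t) t).
  apply: measurable_caratheodory => // j.
  by under eq_fun do rewrite mxE; exact: measurable_funD.
apply: (ae_cvg_measurable (f_ := fun k t => (harmonic k)^-1 *
  (f (harmonic k *: delta_mx 0 i + x t) t - f (x t) t))).
  move=> k; apply: measurable_funM => //; apply: measurable_funB => //.
  exact: measurable_caratheodory.
apply: filterS df => t df Dt; rewrite mxE.
have : derivable (f ^~ t) (x t) (delta_mx 0 i).
  exact: diff_derivable (df Dt (x t)).
move=> /cvgr_dnbhsP/(_ harmonic); apply.
by split=> [k|]; [rewrite gt_eqF ?invr_gt0|exact: cvg_harmonic].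
Qed.

End CompleteMeasure.

(** * Integrals and almost everywhere bounds *)

Section AlmostEverywhereIntegrals.
Context d (T : measurableType d) (R : realType).
Variables (mu : {measure set T -> \bar R}) (D : set T).
Hypothesis mD : measurable D.

Lemma ae_le_integrable (f g : T -> R) :
  measurable_fun D f -> mu.-integrable D (EFin \o g) ->
  (\forall t \ae mu, D t -> `|f t| <= g t) -> mu.-integrable D (EFin \o f).
Proof.
move=> mf ig fg; have /integrableP[mg g_lty] := ig.
apply/integrableP; split; first exact/measurable_EFinP.
apply: le_lt_trans g_lty; apply: ae_ge0_le_integral => //.
- by apply: measurableT_comp => //; exact/measurable_EFinP.
- exact: measurableT_comp.
- apply: filterS fg => t fg Dt /=.
  by rewrite lee_fin (le_trans (fg Dt)) ?ler_norm.
Qed.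

Lemma ae_eq_Rintegral (f g : T -> R) :
  measurable_fun D f -> measurable_fun D g ->
  (\forall t \ae mu, D t -> f t = g t) ->
  \int[mu]_(t in D) f t = \int[mu]_(t in D) g t.
Proof.
move=> mf mg fg; congr fine; apply: ae_eq_integral => //.
- exact/measurable_EFinP.
- exact/measurable_EFinP.
- by apply: filterS fg => t fg Dt /=; rewrite fg.
Qed.

Lemma integrable_mul_bounded (f g : T -> R) (M : R) :
  mu.-integrable D (EFin \o f) -> measurable_fun D g ->
  (\forall t \ae mu, D t -> `|g t| <= M) ->
  mu.-integrable D (EFin \o (fun t => f t * g t)).
Proof.
move=> fi mg gM.
have mf : measurable_fun D f by exact/measurable_EFinP/(measurable_int mu).
apply: (ae_le_integrable (g := fun t => `|M| * `|f t|)).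
- exact: measurable_funM.
- have /(integrableZl mD `|M|) := integrable_norm fi.
  by apply: eq_integrable => // t _.
- apply: filterS gM => t gM Dt; rewrite normrM mulrC ler_wpM2r//.
  by rewrite (le_trans (gM Dt)) ?ler_norm.
Qed.

Lemma dominated_cvg_Rintegral (f_ : nat -> T -> R) (f g : T -> R) :
  (forall k, measurable_fun D (f_ k)) -> measurable_fun D f ->
  (\forall t \ae mu, D t -> f_ k t @[k --> \oo] --> f t) ->
  mu.-integrable D (EFin \o g) ->
  (\forall t \ae mu, D t -> forall k, `|f_ k t| <= g t) ->
  \int[mu]_(t in D) f_ k t @[k --> \oo] --> \int[mu]_(t in D) f t.
Proof.
move=> mf_ mf f_f ig f_g.
have [||||fi _ cf] := @dominated_convergence _ _ _ mu D mD
    (fun k => EFin \o f_ k) (EFin \o f) (EFin \o g) _ _ _ ig.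
- by move=> k; exact/measurable_EFinP.
- exact/measurable_EFinP.
- apply: filterS f_f => t f_f Dt.
  by apply: cvg_EFin; [exact: nearW|exact: f_f].
- by apply: filterS f_g => t f_g k Dt; rewrite lee_fin f_g.
- by apply: fine_cvg; rewrite fineK ?integrable_fin_num.
Qed.

End AlmostEverywhereIntegrals.

(** * Euclidean norm and gradients *)

Section EuclideanNorm.
Context {R : realType}.

Lemma enorm_ge0 {a b : nat} (A : 'M[R]_(a, b)) : 0 <= enorm A.
Proof. exact: sqrtr_ge0. Qed.

Lemma normr_le_enorm {a b : nat} (A : 'M[R]_(a, b)) i j : `|A i j| <= enorm A.
Proof.
rewrite -sqrtr_sqr ler_sqrt; last by do 2!apply: sumr_ge0 => ? _; exact: sqr_ge0.
rewrite (bigD1 i)//= (bigD1 j)//= -addrA lerDl.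
by rewrite addr_ge0// ?sumr_ge0// => *; rewrite ?sumr_ge0// => *; exact: sqr_ge0.
Qed.

(** Comparing with the sum norm provides integrable bounds for [enorm] without
    measurability of the square root. *)
Lemma enorm_le_sum {n : nat} (x : 'rV[R]_n) : enorm x <= \sum_i `|x 0 i|.
Proof.
have s0 : 0 <= \sum_i `|x 0 i| by apply: sumr_ge0.
rewrite -(ger0_norm s0) -sqrtr_sqr ler_sqrt ?sqr_ge0// big_ord1.
rewrite expr2 mulr_suml; apply: ler_sum => i _.
rewrite -real_normK ?num_real// expr2 ler_wpM2l//.
by rewrite (bigD1 i)//= lerDl sumr_ge0.
Qed.

End EuclideanNorm.

Section Gradients.
Context {R : realType} {n : nat}.
Implicit Types (x y : 'rV[R]_n) (f : 'rV[R]_n -> R).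

Lemma differentiable_entry {q : nat} (f : 'rV[R]_n -> 'rV[R]_q) i x :
  differentiable f x -> differentiable (fun y => f y 0 i) x.
Proof.
move=> df; apply: (@differentiable_comp _ _ _ _ f (fun z : 'rV_q => z 0 i)) => //.
exact: differentiable_coord.
Qed.

Lemma is_derive_gradient f x i :
  differentiable f x -> is_derive x (delta_mx 0 i) f (gradient f x 0 i).
Proof. by move=> df; rewrite mxE; apply: derivableP; exact: diff_derivable. Qed.

Lemma gradientP f x (a : 'rV[R]_n) :
  (forall i, is_derive x (delta_mx 0 i) f (a 0 i)) -> gradient f x = a.
Proof. by move=> fa; apply/rowP => i; rewrite mxE; have [_ ->] := fa i. Qed.

Lemma gradientD_lincomb {p m : nat} f (h : 'rV[R]_n -> 'rV[R]_p)
    (g : 'rV[R]_n -> 'rV[R]_m) (u : 'rV[R]_p) (v : 'rV[R]_m) x :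
  differentiable f x -> (forall i, differentiable (fun y => h y 0 i) x) ->
  (forall j, differentiable (fun y => g y 0 j) x) ->
  gradient (fun y => f y + \sum_(i < p) u 0 i * h y 0 i
                         + \sum_(j < m) v 0 j * g y 0 j) x =
  gradient f x + (\sum_(i < p) u 0 i *: gradient (fun y => h y 0 i) x
                + \sum_(j < m) v 0 j *: gradient (fun y => g y 0 j) x).
Proof.
move=> df dh dg; apply: gradientP => k.
have -> : (gradient f x + (\sum_(i < p) u 0 i *: gradient (fun y => h y 0 i) x
      + \sum_(j < m) v 0 j *: gradient (fun y => g y 0 j) x)) 0 k =
    gradient f x 0 k
    + \sum_(i < p) (u 0 i *: (gradient (fun y => h y 0 i) x 0 k : R))
    + \sum_(j < m) (v 0 j *: (gradient (fun y => g y 0 j) x 0 k : R)).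
  rewrite addrA [LHS]mxE [X in X + _]mxE !summxE.
  by congr (_ + _ + _); apply: eq_bigr => i _; rewrite [LHS]mxE.
have -> : (fun y => f y + \sum_(i < p) u 0 i * h y 0 i
                         + \sum_(j < m) v 0 j * g y 0 j) =
    f + \sum_(i < p) (u 0 i \*: (fun y => h y 0 i))
      + \sum_(j < m) (v 0 j \*: (fun y => g y 0 j)).
  by apply/funext => y; rewrite !fctE !fct_sumE.
apply: is_deriveD; first apply: is_deriveD.
- exact: is_derive_gradient.
- apply: is_derive_sum => i; apply: is_deriveZ.
  exact: is_derive_gradient.
- apply: is_derive_sum => j; apply: is_deriveZ.
  exact: is_derive_gradient.
Qed.

Lemma differentiable_dotv (a : 'rV[R]_n) x : differentiable (dotv a) x.
Proof.
have -> : dotv a = \sum_(i < n) (a 0 i \*: (fun y => y 0 i)).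
  by apply/funext => y; rewrite fct_sumE.
apply: differentiable_sum => i; apply: differentiableZ.
exact: differentiable_coord.
Qed.

Lemma gradient_dotv (a : 'rV[R]_n) x : gradient (dotv a) x = a.
Proof.
apply: gradientP => k.
have -> : dotv a = \sum_(i < n) (a 0 i \*: (fun y => y 0 i)).
  by apply/funext => y; rewrite fct_sumE.
have -> : a 0 k = \sum_(i < n) (a 0 i *: (delta_mx 0 k : 'rV[R]_n) 0 i).
  rewrite (bigD1 k)//= big1 ?mxE ?eqxx ?addr0 /GRing.scale/= ?mulr1// => i ik.
  by rewrite mxE (negbTE ik) mulr0.
apply: is_derive_sum => i; apply: is_deriveZ; split.
  by apply: diff_derivable; exact: differentiable_coord.
(* the directional derivative of a coordinate is the matching entry of
   that of the identity *)
have := derive_id x (delta_mx 0 k : 'rV[R]_n).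
rewrite (derive_mx (M := id)); last exact: derivable_id.
by move=> /matrixP/(_ 0 i); rewrite mxE.
Qed.

End Gradients.

(** * Function spaces on the horizon and weak convergence *)

Section FunctionSpaceTheory.
Context {R : realType}.
Variable T : R.

Lemma leb_complete : measure_is_complete (leb R).
Proof. exact: completed_lebesgue_measure_is_complete. Qed.

Lemma measurable_horizon : measurable (horizon T).
Proof. by apply: sub_caratheodory; exact: measurable_itv. Qed.
Local Notation mH := measurable_horizon.

(** As a filter, [ae_on] supports the combination of almost everywhere
    properties by the lemmas on filters, with the restriction to the horizon
    kept implicit. *)
#[global] Instance ae_on_filter : Filter (ae_on T).
Proof.
rewrite /ae_on; split=> [|P Q|P Q PQ]; first exact: aeW.
- by apply: filterS2 => t Pt Qt Ht; split; [exact: Pt|exact: Qt].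
- by apply: filterS => t Pt Ht; exact/PQ/Pt.
Qed.

Lemma ae_on_foralln (P : nat -> R -> Prop) :
  (forall k, ae_on T (P k)) -> ae_on T (fun t => forall k, P k t).
Proof.
move=> aeP; have := ae_foralln aeP; rewrite /ae_on.
by apply: filterS => t Pt Ht k; exact: Pt.
Qed.

Lemma integ_meas (f : R -> R) : integ T f -> meas T f.
Proof. by move=> fi; apply/measurable_EFinP; exact: (measurable_int (leb R)). Qed.

Lemma integD (f g : R -> R) :
  integ T f -> integ T g -> integ T (fun t => f t + g t).
Proof. by move=> fi gi; exact: (integrableD mH fi gi). Qed.

Lemma integZ (a : R) (f : R -> R) : integ T f -> integ T (fun t => a * f t).
Proof. by move=> fi; exact: (integrableZl mH a fi). Qed.

Lemma integ_norm (f : R -> R) : integ T f -> integ T (fun t => `|f t|).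
Proof. by move=> fi; exact: (integrable_norm fi). Qed.

Lemma integ_sum (I : Type) (s : seq I) (f : I -> R -> R) :
  (forall i, integ T (f i)) -> integ T (fun t => \sum_(i <- s) f i t).
Proof.
move=> fi; have := integrable_sum (P := xpredT) mH s (fun i _ => fi i).
apply: (eq_integrable mH) => t _; rewrite /= sumEFin //.
Qed.

Lemma integ_ae_le (f g : R -> R) :
  meas T f -> integ T g -> ae_on T (fun t => `|f t| <= g t) -> integ T f.
Proof. by move=> mf gi fg; exact: (ae_le_integrable mH mf gi fg). Qed.

Section Vectors.
Context {n : nat}.
Implicit Types f g gamma : R -> 'rV[R]_n.

Lemma L1_measv f : L1 T f -> measv T f.
Proof. by move=> fi i; exact: integ_meas. Qed.

Lemma L1D f g : L1 T f -> L1 T g -> L1 T (fun t => f t + g t).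
Proof. by move=> fi gi i; under eq_fun do rewrite mxE; exact: integD. Qed.

Lemma L1N f : L1 T f -> L1 T (fun t => - f t).
Proof.
by move=> fi i; under eq_fun do rewrite mxE -mulN1r; exact: integZ.
Qed.

(** Measurability of the second function comes from completeness of the
    Lebesgue measure. *)
Lemma L1_ae_eq f g : L1 T f -> ae_on T (fun t => f t = g t) -> L1 T g.
Proof.
move=> fi fg i; apply: (integ_ae_le _ (integ_norm (fi i))).
  apply: (ae_eq_measurable leb_complete _ (L1_measv fi i)).
  by apply: filterS fg => t ->.
by apply: filterS fg => t ->.
Qed.

Lemma L1_dotv f gamma :
  L1 T f -> Linf T gamma -> integ T (fun t => dotv (f t) (gamma t)).
Proof.
move=> fi [mg [M gM]]; apply: integ_sum => i.
apply: (integrable_mul_bounded (M := M) mH (fi i) (mg i)).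
by apply: filterS gM => t gM; exact: le_trans (normr_le_enorm _ _ _) gM.
Qed.

Lemma dotvDl (x y z : 'rV[R]_n) : dotv (x + y) z = dotv x z + dotv y z.
Proof.
by rewrite /dotv -big_split; apply: eq_bigr => i _; rewrite mxE mulrDl.
Qed.

Lemma dotvNl (x y : 'rV[R]_n) : dotv (- x) y = - dotv x y.
Proof.
by rewrite /dotv -sumrN; apply: eq_bigr => i _; rewrite mxE mulNr.
Qed.

Lemma dotv0l (x : 'rV[R]_n) : dotv 0 x = 0.
Proof. by rewrite /dotv big1// => i _; rewrite mxE mul0r. Qed.

Lemma weak_cvg_L1D (f g : nat -> R -> 'rV[R]_n) f' g' :
  (forall k, L1 T (f k)) -> (forall k, L1 T (g k)) -> L1 T f' -> L1 T g' ->
  weak_cvg_L1 T f f' -> weak_cvg_L1 T g g' ->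
  weak_cvg_L1 T (fun k t => f k t + g k t) (fun t => f' t + g' t).
Proof.
move=> fi gi fi' gi' ff gg gamma gb.
have intD a b : L1 T a -> L1 T b ->
    \int[leb R]_(t in horizon T) dotv (a t + b t) (gamma t) =
    \int[leb R]_(t in horizon T) dotv (a t) (gamma t) +
    \int[leb R]_(t in horizon T) dotv (b t) (gamma t).
  move=> ai bi; under eq_Rintegral do rewrite dotvDl.
  exact: (RintegralD mH (L1_dotv ai gb) (L1_dotv bi gb)).
rewrite intD//; under eq_fun do rewrite intD//.
by apply: cvgD; [exact: ff|exact: gg].
Qed.

Lemma weak_cvg_L1N (f : nat -> R -> 'rV[R]_n) f' :
  (forall k, L1 T (f k)) -> L1 T f' -> weak_cvg_L1 T f f' ->
  weak_cvg_L1 T (fun k t => - f k t) (fun t => - f' t).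
Proof.
move=> fi fi' ff gamma gb.
have intN a : L1 T a ->
    \int[leb R]_(t in horizon T) dotv (- a t) (gamma t) =
    - \int[leb R]_(t in horizon T) dotv (a t) (gamma t).
  move=> ai; under eq_Rintegral do rewrite dotvNl -mulN1r.
  by rewrite (RintegralZl _ mH (L1_dotv ai gb)) mulN1r.
rewrite intN//; under eq_fun do rewrite intN//.
by apply: cvgN; exact: ff.
Qed.

Lemma weak_cvg_L1_ae_eq (f g : nat -> R -> 'rV[R]_n) f' g' :
  (forall k, L1 T (f k)) -> L1 T f' ->
  (forall k, ae_on T (fun t => f k t = g k t)) ->
  ae_on T (fun t => f' t = g' t) ->
  weak_cvg_L1 T f f' -> weak_cvg_L1 T g g'.
Proof.
move=> fi fi' fg fg' ff gamma gb.
have intE a b : L1 T a -> ae_on T (fun t => a t = b t) ->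
    \int[leb R]_(t in horizon T) dotv (a t) (gamma t) =
    \int[leb R]_(t in horizon T) dotv (b t) (gamma t).
  move=> ai ab; apply: (ae_eq_Rintegral mH).
  - exact: integ_meas (L1_dotv ai gb).
  - exact: integ_meas (L1_dotv (L1_ae_eq ai ab) gb).
  - by apply: filterS ab => t ->.
rewrite -(intE f' g')//; under eq_fun do rewrite -(intE _ _ (fi _) (fg _)).
exact: ff.
Qed.

Lemma L10 : L1 T (fun=> 0 : 'rV[R]_n).
Proof.
move=> i; under eq_fun do rewrite mxE; exact: integrable0.
Qed.

Lemma weak_cvg_L1_0P (f : nat -> R -> 'rV[R]_n) :
  weak_cvg_L1 T f (fun=> 0) <->
  forall gamma, Linf T gamma ->
    \int[leb R]_(t in horizon T) dotv (f k t) (gamma t) @[k --> \oo] --> (0 : R).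
Proof.
suff int0 gamma : \int[leb R]_(t in horizon T) dotv 0 (gamma t) = 0 :> R.
  by split=> f0 gamma /f0; rewrite int0.
under eq_Rintegral do rewrite dotv0l.
by rewrite Rintegral_cst ?mul0r//; exact: measurable_horizon.
Qed.

(** Against a test function bounded by [M], the scalar product of [n] entries
    is dominated by [n * M * c], so dominated convergence applies. *)
Lemma dominated_weak_cvg_L1 (f : nat -> R -> 'rV[R]_n) f' (c : R -> R) :
  (forall k, L1 T (f k)) -> L1 T f' ->
  ae_on T (fun t => f k t @[k --> \oo] --> f' t) ->
  integ T c ->
  ae_on T (fun t => forall k i, `|f k t 0 i| <= c t) ->
  weak_cvg_L1 T f f'.
Proof.
move=> fi fi' ff ci fc gamma gb; have [_ [M gM]] := gb.
apply: (dominated_cvg_Rintegral (g := fun t => (n%:R * `|M|) * c t) mH).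
- by move=> k; exact: integ_meas (L1_dotv (fi k) gb).
- exact: integ_meas (L1_dotv fi' gb).
- apply: filterS ff => t ff; rewrite /dotv; apply: cvg_big => [|i _].
    exact: add_continuous.
  apply: cvgM; last exact: cvg_cst.
  apply: (cvg_comp _ (fun N : 'rV_n => N 0 i) ff).
  exact: coord_continuous.
- exact: integZ.
- apply: filterS2 fc gM => t fc gM k.
  rewrite (le_trans (ler_norm_sum _ _ _))//.
  rewrite -mulrA mulr_natl -[X in _ *+ X]card_ord -sumr_const.
  apply: ler_sum => i _; rewrite normrM mulrC ler_pM ?fc//.
  rewrite (le_trans (normr_le_enorm _ _ _))// (le_trans gM)//.
  exact: ler_norm.
Qed.

End Vectors.
End FunctionSpaceTheory.

(** * Optimality conditions as memberships *)

Section ReferencePoint.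
Context {R : realType} {n p m : nat}.
Variable T : R.
Variables (h : 'rV[R]_n -> R -> 'rV[R]_p) (g : 'rV[R]_n -> R -> 'rV[R]_m).
Variables (xbar : R -> 'rV[R]_n) (r : R).
Implicit Types (phi : 'rV[R]_n -> R -> R) (x psi : R -> 'rV[R]_n).

Lemma C1_vec_hg_entries t : C1_vec (hg h g ^~ t) -> forall y,
  (forall i, differentiable (fun z => h z t 0 i) y) /\
  (forall j, differentiable (fun z => g z t 0 j) y).
Proof.
move=> [dhg _] y; split=> i.
- have := differentiable_entry (lshift m i) (dhg y).
  by under eq_fun do rewrite row_mxEl.
- have := differentiable_entry (rshift p i) (dhg y).
  by under eq_fun do rewrite row_mxEr.
Qed.

Lemma grad_lagrangianE phi y u v t :
  C1 (phi ^~ t) -> C1_vec (hg h g ^~ t) ->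
  grad_lagrangian h g phi y u v t = gradient (phi ^~ t) y +
    (\sum_(i < p) u 0 i *: grad_h h i y t
     + \sum_(j < m) v 0 j *: grad_g g j y t).
Proof.
move=> [dphi _] /C1_vec_hg_entries/(_ y)[dh dg].
exact: (gradientD_lincomb u v (dphi y) dh dg).
Qed.

Lemma L1_gradient phi x : H1 T xbar r phi -> measv T x ->
  ae_on T (fun t => cball xbar r t (x t)) ->
  L1 T (fun t => gradient (phi ^~ t) (x t)).
Proof.
move=> [C1phi mphi _ [c [chat [_ ichat bphi]]]] mx xball i.
apply: (integ_ae_le _ ichat).
  apply: (measurable_gradient leb_complete (measurable_horizon T)) => //.
  by apply: filterS C1phi => t [].
apply: filterS2 bphi xball => t [_ chatP] xt.
exact: le_trans (normr_le_enorm _ _ _) (chatP _ xt).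
Qed.

Lemma oball_cball t y : oball xbar r t y -> cball xbar r t y.
Proof. exact: ltW. Qed.

Hypothesis r_gt0 : 0 < r.

Lemma cball_center t : cball xbar r t (xbar t).
Proof.
rewrite /cball/= subrr (le_trans (enorm_le_sum _))// big1 ?ltW// => i _.
by rewrite mxE normr0.
Qed.

Hypothesis xbar_feasible : feasible T h g xbar.

Let measv_xbar : measv T xbar. Proof. by have [[]] := xbar_feasible. Qed.

Lemma L1_gradient_center phi : H1 T xbar r phi ->
  L1 T (fun t => gradient (phi ^~ t) (xbar t)).
Proof.
move=> H1phi; apply: L1_gradient => //.
by apply: filterE => t; exact: cball_center.
Qed.

(** Continuity of the gradient gives pointwise convergence, and the bound of
    (H1) on the ball of radius [r] dominates. *)
Lemma gradient_weak_cvg phi (x : nat -> R -> 'rV[R]_n) :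
  H1 T xbar r phi -> (forall k, measv T (x k)) ->
  (forall k, ae_on T (fun t => cball xbar r t (x k t))) ->
  ae_on T (fun t => x k t @[k --> \oo] --> xbar t) ->
  weak_cvg_L1 T (fun k t => gradient (phi ^~ t) (x k t))
                (fun t => gradient (phi ^~ t) (xbar t)).
Proof.
move=> H1phi mx xball xcvg.
have [C1phi _ _ [c [chat [_ ichat bphi]]]] := H1phi.
apply: (dominated_weak_cvg_L1 (c := chat)) => //.
- by move=> k; exact: L1_gradient.
- exact: L1_gradient_center.
- apply: filterS2 C1phi xcvg => t [_ cphi] xt.
  exact: (cvg_comp _ _ xt (cphi (xbar t))).
- apply: filterS2 bphi (ae_on_foralln xball) => t [_ chatP] xt k i.
  exact: le_trans (normr_le_enorm _ _ _) (chatP _ (xt k)).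
Qed.

(** The multiplier is bounded, and on the ball of radius [r] the Lipschitz
    bound of (H2) compares [g (x t) t] with [g (xbar t) t], which is
    integrable. *)
Lemma L1_slackness x (v : R -> 'rV[R]_m) : H2 T h g xbar r -> measv T x ->
  ae_on T (fun t => cball xbar r t (x t)) -> Linf T v ->
  L1 T (fun t => \row_j (v t 0 j * gneg g j (x t) t)).
Proof.
move=> [C1hg mhg ihg [c [chat [ic _ cP]]]] mx xball [mv [M vM]] j.
under eq_fun do rewrite mxE mulrC.
suff gi : integ T (fun t => gneg g j (x t) t).
  apply: (integrable_mul_bounded (M := M) (measurable_horizon T) gi (mv j)).
  by apply: filterS vM => t; exact: le_trans (normr_le_enorm _ _ _).
(* the absolute value of [c] is needed: the Lipschitz bound alone does not
   give [0 <= c t] when [n = 0] *)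
have ib : integ T (fun t => enorm (hg h g (xbar t) t) + r * `|c t|).
  by apply: integD => //; apply: integZ; exact: integ_norm.
apply: (integ_ae_le _ ib).
  apply: measurable_maxr => //; apply: measurable_funN.
  apply: (measurable_caratheodory leb_complete (measurable_horizon T)
    (f := fun y t => g y t 0 j)) => //.
    by move=> y; have := mhg y (rshift p j); under eq_fun do rewrite row_mxEr.
  apply: filterS C1hg => t /C1_vec_hg_entries dhg y.
  by apply: differentiable_continuous; have [_] := dhg y; exact.
apply: filterS2 cP xball => t [cP _] xt.
have gE y : g y t 0 j = hg h g y t 0 (rshift p j) by rewrite row_mxEr.
apply: (@le_trans _ _ `|g (x t) t 0 j|).
  by rewrite /gneg; have [_|_] := leP (- g (x t) t 0 j) 0; rewrite ?normrN ?normr0.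
rewrite gE -[X in `|X|](subrK (hg h g (xbar t) t 0 (rshift p j))) addrC.
rewrite (le_trans (ler_normD _ _))// lerD ?normr_le_enorm//.
have -> : hg h g (x t) t 0 (rshift p j) - hg h g (xbar t) t 0 (rshift p j) =
    (hg h g (x t) t - hg h g (xbar t) t) 0 (rshift p j) by rewrite !mxE.
rewrite (le_trans (normr_le_enorm _ _ _))//.
rewrite (le_trans (cP _ _ xt (cball_center t)))// mulrC.
apply: (@le_trans _ _ (enorm (x t - xbar t) * `|c t|)).
  by rewrite ler_wpM2l ?enorm_ge0 ?ler_norm.
exact: ler_wpM2r.
Qed.

Lemma gneg_complementary t (a : R) j : g (xbar t) t 0 j <= 0 ->
  a * gneg g j (xbar t) t = 0 <-> a * g (xbar t) t 0 j = 0.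
Proof.
move=> g_le0; rewrite /gneg max_l ?oppr_ge0// mulrN.
by split=> [/eqP|->]; rewrite ?oppr0// oppr_eq0 => /eqP.
Qed.

(** Stationarity of the Lagrangian says that the multipliers represent
    [- gradient (phi ^~ t) (xbar t)]; the complementarity conditions agree
    because [g <= 0] at [xbar]. *)
Theorem KKT_iff_setM phi : H1 T xbar r phi -> H2 T h g xbar r ->
  KKT T h g phi xbar <->
  setM T h g xbar (fun=> 0) (fun t => - gradient (phi ^~ t) (xbar t)).
Proof.
move=> H1phi H2hg.
have [C1phi _ _ _] := H1phi; have [C1hg _ _ _] := H2hg.
have [_ xbar_ae] := xbar_feasible.
split=> [[_ [u [v [uL vL kkt]]]]|[_ [u [v [uL vL mult]]]]].
  split; first exact/L1N/L1_gradient_center.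
  exists u, v; split=> //.
  apply: filterS3 (filterI C1phi C1hg) xbar_ae kkt => t.
  move=> [cphi chg] [_ g_le0] [grad0 vg].
  split=> [|j]; last first.
    have [vg0 v_ge0] := vg j; split=> //; rewrite mxE.
    by apply/(gneg_complementary _ (g_le0 j)).
  apply/esym/eqP; rewrite -addr_eq0 addrC; apply/eqP.
  by move: grad0; rewrite grad_lagrangianE.
split=> //; exists u, v; split=> //.
apply: filterS3 (filterI C1phi C1hg) xbar_ae mult => t.
move=> [cphi chg] [_ g_le0] [gradE vg].
split=> [|j]; last first.
  have [vg0 v_ge0] := vg j; split=> //.
  by apply/(gneg_complementary _ (g_le0 j)); rewrite vg0 mxE.
by rewrite grad_lagrangianE// -gradE subrr.
Qed.

(** From left to right the slackness products [v k * gneg] serve as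
    [theta k]: they are integrable by [L1_slackness]. From right to left the
    multipliers of the elements [psi k] of [setM (x k) (theta k)] form the
    AKKT sequence. In both directions the weak limit of the gradients of [phi]
    transfers the convergence. *)
Theorem pw_AKKT_iff_wlimsup_M phi : H1 T xbar r phi -> H2 T h g xbar r ->
  pw_AKKT T h g xbar r phi <->
  wlimsup_M T h g xbar r (fun t => - gradient (phi ^~ t) (xbar t)).
Proof.
move=> H1phi H2hg.
have [C1phi _ _ _] := H1phi; have [C1hg _ _ _] := H2hg.
have L1c := L1_gradient_center H1phi.
split=> [[_ [x [u [v [[xuvL L1lag lag0 slack] xcvg xball]]]]]|].
  have mx k : measv T (x k) by have [[]] := xuvL k.
  have xcball k : ae_on T (fun t => cball xbar r t (x k t)).
    by apply: filterS (xball k) => t; exact: oball_cball.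
  have L1phi k : L1 T (fun t => gradient (phi ^~ t) (x k t)).
    exact: L1_gradient.
  have slackP : ae_on T (fun t => forall j,
      (v k t 0 j * gneg g j (x k t) t @[k --> \oo] --> (0 : R)) /\
      forall k, 0 <= v k t 0 j) by exact: (@filter_forall _ _ _ (ae_on T) _ slack).
  split; first exact: L1N.
  exists x, (fun k t => \row_j (v k t 0 j * gneg g j (x k t) t)).
  exists (fun k t => grad_lagrangian h g phi (x k t) (u k t) (v k t) t
                     - gradient (phi ^~ t) (x k t)).
  split.
  - move=> k; have [xL _ vL] := xuvL k; split=> //; split.
      exact: L1_slackness.
    apply: filterS slackP => t vP j; rewrite mxE.
    by have [_ v_ge0] := vP j; rewrite mulr_ge0// le_max lexx orbT.
  - apply: filterS2 xcvg slackP => t xt vP; split=> //.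
    apply: cvg_rV => j; rewrite mxE; under eq_fun do rewrite mxE.
    by have [] := vP j.
  - move=> k; split; first by apply: L1D => //; exact: L1N.
    have [_ uL vL] := xuvL k; exists (u k), (v k); split=> //.
    apply: filterS3 C1phi C1hg slackP => t cphi chg vP.
    rewrite grad_lagrangianE// addrC addKr; split=> // j.
    by rewrite mxE; have [_ v_ge0] := vP j.
  - rewrite (_ : (fun t => - _) =
        (fun t => 0 + - gradient (phi ^~ t) (xbar t))); last first.
      by apply/funext => t; rewrite add0r.
    apply: (weak_cvg_L1D L1lag (fun k => L1N (L1phi k)) (@L10 _ T n) (L1N L1c)).
      exact/weak_cvg_L1_0P.
    by apply: weak_cvg_L1N => //; exact: gradient_weak_cvg.
move=> [_ [x [theta [psi [EF xtheta_cvg psiM psi_cvg]]]]].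
split=> //.
have /choice[uv uvP] k : exists uv : (R -> 'rV[R]_p) * (R -> 'rV[R]_m),
    [/\ Linf T uv.1, Linf T uv.2 &
      ae_on T (fun t =>
        psi k t = \sum_(i < p) uv.1 t 0 i *: grad_h h i (x k t) t
                    + \sum_(j < m) uv.2 t 0 j *: grad_g g j (x k t) t /\
        forall j, uv.2 t 0 j * gneg g j (x k t) t = theta k t 0 j /\
                  0 <= uv.2 t 0 j)].
  by have [_ [u [v uvP]]] := psiM k; exists (u, v).
have psiL k : L1 T (psi k) by have [] := psiM k.
have xL k : Linf T (x k) by have [[]] := EF k.
have mx k : measv T (x k) by have [] := xL k.
have xball k : ae_on T (fun t => oball xbar r t (x k t)).
  by have [[]] := EF k.
have xcball k : ae_on T (fun t => cball xbar r t (x k t)).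
  by apply: filterS (xball k) => t; exact: oball_cball.
have xcvg : ae_on T (fun t => x k t @[k --> \oo] --> xbar t).
  by apply: filterS xtheta_cvg => t [].
have L1phi k : L1 T (fun t => gradient (phi ^~ t) (x k t)).
  exact: L1_gradient.
have lagE k : ae_on T (fun t => psi k t + gradient (phi ^~ t) (x k t) =
    grad_lagrangian h g phi (x k t) ((uv k).1 t) ((uv k).2 t) t).
  have [_ _ psiE] := uvP k.
  apply: filterS3 C1phi C1hg psiE => t cphi chg [-> _].
  by rewrite grad_lagrangianE// addrC.
have L1sum k := L1D (psiL k) (L1phi k).
exists x, (fun k => (uv k).1), (fun k => (uv k).2); split=> //; split.
- by move=> k; have [] := uvP k.
- by move=> k; exact: L1_ae_eq (L1sum k) (lagE k).
- apply/weak_cvg_L1_0P.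
  apply: (weak_cvg_L1_ae_eq L1sum _ lagE); last first.
  + apply: (weak_cvg_L1D psiL L1phi (L1N L1c) L1c psi_cvg).
    exact: gradient_weak_cvg.
  + by apply: filterE => t; rewrite addNr.
  + exact: L1D (L1N L1c) L1c.
- move=> j.
  have uvP' : ae_on T (fun t => forall k,
      (uv k).2 t 0 j * gneg g j (x k t) t = theta k t 0 j /\
      0 <= (uv k).2 t 0 j).
    apply: ae_on_foralln => k; have [_ _] := uvP k.
    by apply: filterS => t [_]; exact.
  apply: filterS2 uvP' xtheta_cvg => t vP [_ theta_cvg].
  split=> [|k]; last by have [] := vP k.
  under eq_fun do rewrite (vP _).1.
  have := cvg_comp _ (fun N : 'rV_m => N 0 j) theta_cvg.
  move=> /(_ _ (@coord_continuous _ _ _ _ _ _)); rewrite mxE; exact.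
Qed.

(** [enorm (psi t)] is bounded by the sum of the absolute values of the
    entries, which serves both as Lipschitz constant and as bound of the
    gradient. *)
Lemma H1_dotv psi : L1 T psi -> H1 T xbar r (fun y t => dotv (psi t) y).
Proof.
move=> psiL.
have is1 : integ T (fun t => \sum_i `|psi t 0 i|).
  by apply: integ_sum => i; exact: integ_norm.
split.
- apply: filterE => t; split=> [y|]; first exact: differentiable_dotv.
  rewrite (_ : gradient _ = cst (psi t)); first exact: cst_continuous.
  by apply/funext => y; exact: gradient_dotv.
- move=> y; apply: measurable_sum => i; apply: measurable_funM => //.
  exact: L1_measv.
- by apply: integ_norm; apply: L1_dotv; have [] := xbar_feasible.
- exists (fun t => \sum_i `|psi t 0 i|), (fun t => \sum_i `|psi t 0 i|).
  split=> //; apply: filterE => t; split=> [y z _ _|y _].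
    rewrite /dotv -sumrB mulr_suml (le_trans (ler_norm_sum _ _ _))//.
    apply: ler_sum => i _; rewrite -mulrBr normrM ler_wpM2l//.
    by have := normr_le_enorm (y - z) 0 i; rewrite !mxE.
  by rewrite gradient_dotv enorm_le_sum.
Qed.

End ReferencePoint.

(** * AKKT-regularity *)

Theorem theorem3p2 (R : realType) (n p m : nat) (T : R)
    (phi : 'rV[R]_n -> R -> R)
    (h : 'rV[R]_n -> R -> 'rV[R]_p) (g : 'rV[R]_n -> R -> 'rV[R]_m)
    (xbar : R -> 'rV[R]_n) (r : R)
    (T_gt0 : 0 < T) (r_gt0 : 0 < r)
    (xbar_feasible : feasible T h g xbar)
    (phi_H1 : H1 T xbar r phi) (hg_H2 : H2 T h g xbar r) :
  (AKKT_regular T h g xbar r ->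
     pw_AKKT T h g xbar r phi -> KKT T h g phi xbar) /\
  ((forall phi' : 'rV[R]_n -> R -> R, H1 T xbar r phi' ->
      pw_AKKT T h g xbar r phi' -> KKT T h g phi' xbar) ->
   AKKT_regular T h g xbar r).
Proof.
split=> [regular akkt|akkt_kkt psi psi_lim].
  apply/(KKT_iff_setM r_gt0 xbar_feasible phi_H1 hg_H2)/regular.
  exact/(pw_AKKT_iff_wlimsup_M r_gt0 xbar_feasible phi_H1 hg_H2).
pose phi' (y : 'rV[R]_n) (t : R) := dotv (- psi t) y.
have phi'_H1 : H1 T xbar r phi'.
  by apply: (H1_dotv _ xbar_feasible); apply: L1N; have [] := psi_lim.
have psiE : (fun t => - gradient (phi' ^~ t) (xbar t)) = psi.
  apply/funext => t; rewrite -[RHS]opprK; congr (- _).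
  exact: gradient_dotv.
rewrite -psiE; apply/(KKT_iff_setM r_gt0 xbar_feasible phi'_H1 hg_H2).
apply: akkt_kkt => //.
by apply/(pw_AKKT_iff_wlimsup_M r_gt0 xbar_feasible phi'_H1 hg_H2); rewrite psiE.
Qed.
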